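(* Let $(\mathfrak{g},r)$ be a quasitriangular Lie bialgebra over a field $k$ (possibly infinite dimensional), with double $\mathcal{D}(\mathfrak{g})=\mathfrak{g}\oplus\mathfrak{g}^*$. Regard $\mathfrak{f}^\perp$ as an abelian Lie algebra. Define $i\colon \mathfrak{f}^\perp\to\mathcal{D}(\mathfrak{g})$ by $i(\eta)=\eta-r_+(\eta)$ and $p\colon\mathcal{D}(\mathfrak{g})\to\mathfrak{g}\ltimes\mathfrak{f}$ by $p(x+\xi)=(x+r_+(\xi),\,-(r_+-r_-)(\xi))$ for $x\in\mathfrak{g}$, $\xi\in\mathfrak{g}^*$. Then $$0\to\mathfrak{f}^\perp\xrightarrow{\ i\ }\mathcal{D}(\mathfrak{g})\xrightarrow{\ p\ }\mathfrak{g}\ltimes\mathfrak{f}\to 0$$ is an exact sequence of Lie algebras.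
   Context: A Lie bialgebra $\mathfrak{g}$ with cobracket $\delta$ is quasitriangular with $r$-matrix $r\in\mathfrak{g}\otimes\mathfrak{g}$ if $\delta(x)=(\mathrm{ad}_x\otimes\mathrm{id}+\mathrm{id}\otimes\mathrm{ad}_x)r$ for all $x\in\mathfrak{g}$ and $[r_{12},r_{13}]+[r_{12},r_{23}]+[r_{13},r_{23}]=0$. The dual space $\mathfrak{g}^*$ is a Lie algebra via $\langle[\xi_1,\xi_2],x\rangle=\langle\xi_1\otimes\xi_2,\delta(x)\rangle$. Coadjoint actions: $\langle\mathrm{ad}^*_x\xi,y\rangle=-\langle\xi,[x,y]\rangle$ for $x,y\in\mathfrak{g}$, $\xi\in\mathfrak{g}^*$, and $\mathrm{ad}^*_\xi x\in\mathfrak{g}$ is given by $\langle\mathrm{ad}^*_\xi x,\xi_0\rangle=-\langle x,[\xi,\xi_0]\rangle$. As a Lie algebra, the double $\mathcal{D}(\mathfrak{g})$ is the vector space $\mathfrak{g}\oplus\mathfrak{g}^*$ in which $\mathfrak{g}$ and $\mathfrak{g}^*$ are subalgebras and $[x,\xi]=\mathrm{ad}^*_x(\xi)-\mathrm{ad}^*_\xi(x)$. The maps $r_\pm\colon\mathfrak{g}^*\to\mathfrak{g}$ are $r_+(\xi)=(\xi\otimes\mathrm{id})r$ and $r_-(\xi)=-(\mathrm{id}\otimes\xi)r$. Let $\mathfrak{f}\subset\mathfrak{g}$ be the span of all components of the tensor $\Omega=r+r_{21}\in S^2(\mathfrak{g})$; it is an ideal of $\mathfrak{g}$ and $\mathfrak{f}=\mathrm{Im}(r_+-r_-)$.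 Let $\mathfrak{f}^\perp=\{\eta\in\mathfrak{g}^*\mid\langle\eta,y\rangle=0\ \forall y\in\mathfrak{f}\}=\mathrm{Ker}(r_+-r_-)$. The semidirect sum $\mathfrak{g}\ltimes\mathfrak{f}$ is $\mathfrak{g}\oplus\mathfrak{f}$ as a vector space, with $\mathfrak{g}$ acting on $\mathfrak{f}$ by the adjoint action: $[(x_1,y_1),(x_2,y_2)]=([x_1,x_2],[x_1,y_2]-[x_2,y_1]+[y_1,y_2])$. *)

(* Defs.v *)
From HB Require Import structures.
From mathcomp Require Import all_boot all_algebra.
From mathcomp Require Import generic_quotient boolp.

Set Implicit Arguments.
Unset Strict Implicit.
Unset Printing Implicit Defensive.

Import GRing.Theory.
Local Open Scope ring_scope.
Local Open Scope quotient_scope.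

Section Tensor.
Variables (k : fieldType) (V W : lmodType k).

Definition bisum (U : nmodType) (B : V -> W -> U) (s : seq (V * W)) : U :=
  \sum_(p <- s) B p.1 p.2.

(* Formal sums of pairs are identified when no bilinear map into any vector
   space separates them; this kernel is the usual congruence generated by the
   bilinearity relations. *)
Definition tensor_rel : rel (seq (V * W)) := fun s t =>
  `[< forall (U : lmodType k) (B : {bilinear V -> W -> U}),
        bisum B s = bisum B t >].

Lemma tensor_rel_refl : reflexive tensor_rel.
Proof. by move=> s; apply/asboolP. Qed.

Lemma tensor_rel_sym : symmetric tensor_rel.
Proof. by move=> s t; apply/asboolP/asboolP => st U B; rewrite st. Qed.

Lemma tensor_rel_trans : transitive tensor_rel.
Proof.
by move=> t s u /asboolP st /asboolP tu; apply/asboolP => U B; rewrite st.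
Qed.

Canonical tensor_equiv :=
  EquivRel tensor_rel tensor_rel_refl tensor_rel_sym tensor_rel_trans.

Definition tensor := {eq_quot tensor_equiv}.

HB.instance Definition _ := Choice.on tensor.

(* The linear map induced by B; only meaningful when B is bilinear. *)
Definition tlift (U : nmodType) (B : V -> W -> U) (t : tensor) : U :=
  bisum B (repr t).

Definition tens (v : V) (w : W) : tensor := \pi_tensor [:: (v, w)].
Definition tzero : tensor := \pi_tensor [::].
Definition tadd (t u : tensor) : tensor := \pi_tensor (repr t ++ repr u).
Definition tscale (a : k) (t : tensor) : tensor :=
  \pi_tensor [seq (a *: p.1, p.2) | p <- repr t].
Definition topp : tensor -> tensor := tscale (-1).

Lemma tlift_pi (U : lmodType k) (B : {bilinear V -> W -> U}) s :
  tlift B (\pi_tensor s) = bisum B s.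
Proof.
have /eqmodP /asboolP H : \pi_tensor (repr (\pi_tensor s)) = \pi_tensor s.
  by rewrite reprK.
exact: H.
Qed.

Lemma tensor_sep (t u : tensor) :
  (forall (U : lmodType k) (B : {bilinear V -> W -> U}),
     tlift B t = tlift B u) -> t = u.
Proof.
move=> H; rewrite -[t]reprK -[u]reprK; apply/eqmodP/asboolP => U B.
exact: H.
Qed.

Lemma tlift_zero (U : lmodType k) (B : {bilinear V -> W -> U}) :
  tlift B tzero = 0.
Proof. by rewrite tlift_pi /bisum big_nil. Qed.

Lemma tlift_add (U : lmodType k) (B : {bilinear V -> W -> U}) t u :
  tlift B (tadd t u) = tlift B t + tlift B u.
Proof. by rewrite tlift_pi /bisum big_cat. Qed.

Lemma tlift_scale (U : lmodType k) (B : {bilinear V -> W -> U}) a t :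
  tlift B (tscale a t) = a *: tlift B t.
Proof.
rewrite tlift_pi /bisum big_map scaler_sumr; apply: eq_bigr => p _ /=.
by rewrite linearZl_LR.
Qed.

Lemma taddA : associative tadd.
Proof.
by move=> t u v; apply: tensor_sep => U B; rewrite !tlift_add addrA.
Qed.

Lemma taddC : commutative tadd.
Proof. by move=> t u; apply: tensor_sep => U B; rewrite !tlift_add addrC. Qed.

Lemma tadd0 : left_id tzero tadd.
Proof.
by move=> t; apply: tensor_sep => U B; rewrite tlift_add tlift_zero add0r.
Qed.

Lemma taddN : left_inverse tzero topp tadd.
Proof.
move=> t; apply: tensor_sep => U B.
by rewrite tlift_add tlift_zero tlift_scale scaleN1r addNr.
Qed.

HB.instance Definition _ := GRing.isZmodule.Build tensor taddA taddC tadd0 taddN.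

Lemma tscaleA a b t : tscale a (tscale b t) = tscale (a * b) t.
Proof. by apply: tensor_sep => U B; rewrite !tlift_scale scalerA. Qed.

Lemma tscale1 : left_id 1 tscale.
Proof. by move=> t; apply: tensor_sep => U B; rewrite tlift_scale scale1r. Qed.

Lemma tscaleDr : right_distributive tscale +%R.
Proof.
move=> a t u; apply: tensor_sep => U B.
by rewrite tlift_add !tlift_scale tlift_add scalerDr.
Qed.

Lemma tscaleDl t : {morph tscale^~ t : a b / a + b}.
Proof.
move=> a b; apply: tensor_sep => U B.
by rewrite tlift_add !tlift_scale scalerDl.
Qed.

HB.instance Definition _ :=
  GRing.Zmodule_isLmodule.Build k tensor tscaleA tscale1 tscaleDr tscaleDl.

Lemma tens_bilinear : bilinear_for *:%R *:%R tens.
Proof.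
by split=> [w a v v'|v a w w']; apply: tensor_sep => U B;
  rewrite tlift_add tlift_scale !tlift_pi /bisum !big_seq1 /= ?linearPl
          ?linearPr.
Qed.

HB.instance Definition _ := bilinear_isBilinear.Build k V W tensor
  *:%R *:%R tens tens_bilinear.

Lemma tlift_is_linear (U : lmodType k) (B : V -> W -> U) :
  bilinear_for *:%R *:%R B -> linear (tlift B).
Proof.
move=> Bbil a t u.
pose B' : {bilinear V -> W -> U} := HB.pack B
  (bilinear_isBilinear.Build k V W U *:%R *:%R B Bbil).
by rewrite -[tlift B]/(tlift B') [LHS]tlift_add tlift_scale.
Qed.

Lemma tliftE (U : lmodType k) (B : V -> W -> U) v w :
  bilinear_for *:%R *:%R B -> tlift B (tens v w) = B v w.
Proof.
move=> Bbil.
pose B' : {bilinear V -> W -> U} := HB.pack B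
  (bilinear_isBilinear.Build k V W U *:%R *:%R B Bbil).
by rewrite -[tlift B]/(tlift B') tlift_pi /bisum big_seq1.
Qed.

Lemma tensor_eq (U : lmodType k) (f h : tensor -> U) :
  linear f -> linear h -> (forall v w, f (tens v w) = h (tens v w)) -> f =1 h.
Proof.
move=> flin hlin fh t.
pose F : {linear tensor -> U} :=
  HB.pack f (GRing.isLinear.Build k tensor U *:%R f flin).
pose H : {linear tensor -> U} :=
  HB.pack h (GRing.isLinear.Build k tensor U *:%R h hlin).
have -> : t = \sum_(p <- repr t) tens p.1 p.2.
  apply: tensor_sep => X B.
  pose L : {linear tensor -> X} := HB.pack (tlift B)
    (GRing.isLinear.Build k tensor X *:%R (tlift B) (tlift_is_linear
      ((fun w a => linearPl B w a), (fun v a => linearPr B v a)))).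
  rewrite -[RHS]/(L _) linear_sum /= /tlift {1}/bisum.
  apply: eq_bigr => p _; rewrite -/(tlift B (tens p.1 p.2)).
  by rewrite tlift_pi /bisum big_seq1.
rewrite -[f _]/(F _) -[h _]/(H _) !linear_sum.
by apply: eq_bigr => p _; exact: fh.
Qed.

Lemma tlift_linB (U : lmodType k) (B1 B2 B3 : V -> W -> U) a t :
  (forall v w, B3 v w = a *: B1 v w + B2 v w) ->
  tlift B3 t = a *: tlift B1 t + tlift B2 t.
Proof.
move=> B123; rewrite /tlift /bisum scaler_sumr -big_split.
by apply: eq_bigr => p _ /=.
Qed.
End Tensor.

Notation "v ⊗ w" := (tens v w) (at level 40, left associativity) : ring_scope.

Section Dual.
Variables (k : fieldType) (V : lmodType k).

Definition dualsp := {scalar V}.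

HB.instance Definition _ := gen_eqMixin dualsp.
HB.instance Definition _ := gen_choiceMixin dualsp.

Definition mkdual (f : V -> k) (flin : linear (f : V -> k^o)) : dualsp :=
  HB.pack f (GRing.isLinear.Build k V k *%R f flin).

Lemma dualP (xi eta : dualsp) : (forall x, xi x = eta x) -> xi = eta.
Proof.
case: xi eta => [f [[mf1] [mf2]]] [h [[mh1] [mh2]]] /= /funext fh.
rewrite {}fh in mf1 mf2 *.
by rewrite (Prop_irrelevance mf1 mh1) (Prop_irrelevance mf2 mh2).
Qed.

Lemma dual_add_subproof (xi eta : dualsp) :
  linear ((fun x => xi x + eta x) : V -> k^o).
Proof. by move=> a x y; rewrite !linearP /= scalerDr addrACA. Qed.

Lemma dual_scale_subproof (a : k) (xi : dualsp) :
  linear ((fun x => a * xi x) : V -> k^o).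
Proof. by move=> b x y; rewrite linearP mulrDr mulrCA. Qed.

Definition dual_zero : dualsp := \0.
Definition dual_add (xi eta : dualsp) := mkdual (dual_add_subproof xi eta).
Definition dual_scale (a : k) (xi : dualsp) := mkdual (dual_scale_subproof a xi).
Definition dual_opp := dual_scale (-1).

Lemma dual_addA : associative dual_add.
Proof. by move=> t u v; apply: dualP => x /=; rewrite addrA. Qed.

Lemma dual_addC : commutative dual_add.
Proof. by move=> t u; apply: dualP => x /=; rewrite addrC. Qed.

Lemma dual_add0 : left_id dual_zero dual_add.
Proof. by move=> t; apply: dualP => x /=; rewrite add0r. Qed.

Lemma dual_addN : left_inverse dual_zero dual_opp dual_add.
Proof. by move=> t; apply: dualP => x /=; rewrite mulN1r addNr. Qed.

HB.instance Definition _ :=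
  GRing.isZmodule.Build dualsp dual_addA dual_addC dual_add0 dual_addN.

Lemma dual_scaleA a b t : dual_scale a (dual_scale b t) = dual_scale (a * b) t.
Proof. by apply: dualP => x /=; rewrite mulrA. Qed.

Lemma dual_scale1 : left_id 1 dual_scale.
Proof. by move=> t; apply: dualP => x /=; rewrite mul1r. Qed.

Lemma dual_scaleDr : right_distributive dual_scale +%R.
Proof. by move=> a t u; apply: dualP => x /=; rewrite mulrDr. Qed.

Lemma dual_scaleDl t : {morph dual_scale^~ t : a b / a + b}.
Proof. by move=> a b; apply: dualP => x /=; rewrite mulrDl. Qed.

HB.instance Definition _ := GRing.Zmodule_isLmodule.Build k dualsp
  dual_scaleA dual_scale1 dual_scaleDr dual_scaleDl.

Lemma dualD (xi eta : dualsp) x : (xi + eta) x = xi x + eta x.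
Proof. by []. Qed.

Lemma dualZ a (xi : dualsp) x : (a *: xi) x = a * xi x.
Proof. by []. Qed.

Lemma dualN (xi : dualsp) x : (- xi) x = - xi x.
Proof. exact: mulN1r. Qed.

Lemma dual0 x : (0 : dualsp) x = 0.
Proof. by []. Qed.
End Dual.

Section Contractions.
Variables (k : fieldType) (V : lmodType k).
Implicit Types (xi eta : dualsp V) (t : tensor V V).

(* (xi ⊗ id) t, (id ⊗ xi) t, <xi ⊗ eta, t> and t_21 *)
Definition contrl xi t : V := tlift (fun a b => xi a *: b) t.
Definition contrr xi t : V := tlift (fun a b => xi b *: a) t.
Definition tpair xi eta t : k := tlift (fun a b => xi a * eta b) t.
Definition tswap t : tensor V V := tlift (fun a b => b ⊗ a) t.

Lemma contrl_bil xi : bilinear_for *:%R *:%R (fun a b : V => xi a *: b).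
Proof.
split=> [w a v v'|v a w w'] /=; first by rewrite linearP scalerDl scalerA.
by rewrite scalerDr !scalerA mulrC.
Qed.

Lemma contrr_bil xi : bilinear_for *:%R *:%R (fun a b : V => xi b *: a).
Proof.
split=> [w a v v'|v a w w'] /=; last by rewrite linearP scalerDl scalerA.
by rewrite scalerDr !scalerA mulrC.
Qed.

Lemma tpair_bil xi eta :
  bilinear_for *:%R *:%R ((fun a b => xi a * eta b) : V -> V -> k^o).
Proof.
split=> [w a v v'|v a w w'] /=; rewrite linearP ?mulrDl ?mulrDr.
  by rewrite -mulrA.
by rewrite mulrCA.
Qed.

Lemma tswap_bil : bilinear_for *:%R *:%R (fun a b : V => b ⊗ a).
Proof. by split=> [w a v v'|v a w w'] /=; rewrite ?linearPl ?linearPr. Qed.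

Lemma contrl_linear xi : linear (contrl xi).
Proof. exact: tlift_is_linear (contrl_bil xi). Qed.
Lemma contrr_linear xi : linear (contrr xi).
Proof. exact: tlift_is_linear (contrr_bil xi). Qed.
Lemma tpair_linear xi eta : linear (tpair xi eta : tensor V V -> k^o).
Proof. exact: tlift_is_linear (tpair_bil xi eta). Qed.
Lemma tswap_linear : linear tswap.
Proof. exact: tlift_is_linear tswap_bil. Qed.

HB.instance Definition _ xi := GRing.isLinear.Build k (tensor V V) V *:%R
  (contrl xi) (contrl_linear xi).
HB.instance Definition _ xi := GRing.isLinear.Build k (tensor V V) V *:%R
  (contrr xi) (contrr_linear xi).
HB.instance Definition _ xi eta := GRing.isLinear.Build k (tensor V V) k *%R
  (tpair xi eta) (tpair_linear xi eta).
HB.instance Definition _ := GRing.isLinear.Build k (tensor V V) (tensor V V)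
  *:%R tswap tswap_linear.

Lemma contrlE xi v w : contrl xi (v ⊗ w) = xi v *: w.
Proof. exact: tliftE (contrl_bil xi). Qed.
Lemma contrrE xi v w : contrr xi (v ⊗ w) = xi w *: v.
Proof. exact: tliftE (contrr_bil xi). Qed.
Lemma tpairE xi eta v w : tpair xi eta (v ⊗ w) = xi v * eta w.
Proof. exact: (tliftE (U := k^o) _ _ (tpair_bil xi eta)). Qed.
Lemma tswapE v w : tswap (v ⊗ w) = w ⊗ v.
Proof. exact: tliftE tswap_bil. Qed.

Lemma tswapK : involutive tswap.
Proof.
apply: (tensor_eq (f := fun t => tswap (tswap t)) (h := id)) => // [a t u|v w].
  by rewrite !linearP.
by rewrite !tswapE.
Qed.

Lemma contrl_swap xi t : contrl xi (tswap t) = contrr xi t.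
Proof.
apply: (tensor_eq (f := fun t => contrl xi (tswap t))) t => [a t u|a t u|v w].
- by rewrite !linearP.
- by rewrite linearP.
- by rewrite tswapE contrlE contrrE.
Qed.

Lemma contrr_swap xi t : contrr xi (tswap t) = contrl xi t.
Proof.
apply: (tensor_eq (f := fun t => contrr xi (tswap t))) t => [a t u|a t u|v w].
- by rewrite !linearP.
- by rewrite linearP.
- by rewrite tswapE contrlE contrrE.
Qed.

Lemma tpair_contrl xi eta t : tpair xi eta t = eta (contrl xi t).
Proof.
apply: (tensor_eq (U := k^o) (h := fun t => eta (contrl xi t))) t
  => [a t u|a t u|v w]; [by rewrite linearP|by rewrite !linearP|].
by rewrite tpairE contrlE linearZ.
Qed.

Lemma tpair_contrr xi eta t : tpair xi eta t = xi (contrr eta t).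
Proof.
apply: (tensor_eq (U := k^o) (h := fun t => xi (contrr eta t))) t
  => [a t u|a t u|v w]; [by rewrite linearP|by rewrite !linearP|].
by rewrite tpairE contrrE linearZ /= mulrC.
Qed.

Lemma contrlDl a xi eta t :
  contrl (a *: xi + eta) t = a *: contrl xi t + contrl eta t.
Proof.
rewrite /contrl /tlift /bisum scaler_sumr -big_split; apply: eq_bigr => p _ /=.
by rewrite scalerDl scalerA.
Qed.

Lemma contrlD xi eta t :
  contrl (xi + eta) t = contrl xi t + contrl eta t.
Proof. by have := contrlDl 1 xi eta t; rewrite !scale1r. Qed.

Lemma contrl0 t : contrl 0 t = 0.
Proof. by apply: (@addrI _ (contrl 0 t)); rewrite -contrlD !addr0. Qed.

Lemma contrlN xi t : contrl (- xi) t = - contrl xi t.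
Proof. by apply/eqP; rewrite -addr_eq0 -contrlD addNr contrl0. Qed.
End Contractions.

HB.mixin Record Lmodule_isLie (k : fieldType) g of GRing.Lmodule k g := {
  lie : g -> g -> g;
  lie_bilinear : bilinear_for *:%R *:%R lie;
  liexx : forall x, lie x x = 0;
  lie_jacobi : forall x y z,
    lie x (lie y z) + lie y (lie z x) + lie z (lie x y) = 0
}.

#[short(type="lieAlgType")]
HB.structure Definition LieAlgebra (k : fieldType) :=
  {g of Lmodule_isLie k g & GRing.Lmodule k g}.

Notation "⁅ x , y ⁆" := (lie x y) (at level 0) : ring_scope.

HB.instance Definition _ (k : fieldType) (g : lieAlgType k) :=
  bilinear_isBilinear.Build k g g g *:%R *:%R lie lie_bilinear.

Section LieTheory.
Variables (k : fieldType) (g : lieAlgType k).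
Implicit Types (x y z : g) (t r : tensor g g) (xi : dualsp g).

Lemma lieC x y : ⁅x, y⁆ = - ⁅y, x⁆.
Proof.
apply/eqP; rewrite -addr_eq0; apply/eqP.
by have := liexx (x + y); rewrite linearDl !linearDr /= !liexx add0r addr0.
Qed.

(* (ad_x ⊗ id + id ⊗ ad_x) t *)
Definition adT x t : tensor g g := tlift (fun a b => ⁅x, a⁆ ⊗ b + a ⊗ ⁅x, b⁆) t.

(* For r = sum a ⊗ b and a copy sum a' ⊗ b' of it, the three summands are
   [r_12, r_13], [r_12, r_23] and [r_13, r_23], in (g ⊗ g) ⊗ g. *)
Definition cybe r : tensor (tensor g g) g :=
  tlift (fun a b => tlift (fun a' b' => ⁅a, a'⁆ ⊗ b ⊗ b') r) r
  + tlift (fun a b => tlift (fun a' b' => a ⊗ ⁅b, a'⁆ ⊗ b') r) r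
  + tlift (fun a b => tlift (fun a' b' => a ⊗ a' ⊗ ⁅b, b'⁆) r) r.

Lemma adT_bil x : bilinear_for *:%R *:%R
  (fun a b => ⁅x, a⁆ ⊗ b + a ⊗ ⁅x, b⁆ : tensor g g).
Proof.
split=> [w a v v'|v a w w'] /=;
  by rewrite !(linearPr, linearPl) scalerDr addrACA.
Qed.

Lemma adT_linear x : linear (adT x).
Proof. exact: tlift_is_linear (adT_bil x). Qed.

HB.instance Definition _ x := GRing.isLinear.Build k (tensor g g) (tensor g g)
  *:%R (adT x) (adT_linear x).

Lemma adTE x a b : adT x (a ⊗ b) = ⁅x, a⁆ ⊗ b + a ⊗ ⁅x, b⁆.
Proof. exact: tliftE (adT_bil x). Qed.

Lemma adT_swap x t : adT x (tswap t) = tswap (adT x t).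
Proof.
apply: (tensor_eq (f := fun t => adT x (tswap t))
  (h := fun t => tswap (adT x t))) t => [a t u|a t u|v w].
- by rewrite !linearP.
- by rewrite !linearP.
- by rewrite tswapE !adTE linearD /= !tswapE addrC.
Qed.

Lemma coad_subproof x xi : linear ((fun y => - xi ⁅x, y⁆) : g -> k^o).
Proof. by move=> a y z; rewrite linearPr linearP opprD scalerN. Qed.

(* ad*_x xi for x in g, xi in g* *)
Definition coad x xi : dualsp g := mkdual (coad_subproof x xi).

Lemma coadE x xi y : coad x xi y = - xi ⁅x, y⁆.
Proof. by []. Qed.

Lemma contrl_adT x xi t :
  contrl xi (adT x t) = ⁅x, contrl xi t⁆ - contrl (coad x xi) t.
Proof.
apply: (tensor_eq (f := fun t => contrl xi (adT x t))
  (h := fun t => ⁅x, contrl xi t⁆ - contrl (coad x xi) t)) t => [a t u|a t u|v w].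
- by rewrite !linearP.
- by rewrite linearP (linearP (contrl _)) linearPr /= scalerBr opprD addrACA.
- rewrite adTE linearD /= !contrlE linearZr_LR coadE /= scaleNr opprK.
  by rewrite addrC.
Qed.
End LieTheory.

(* (f ⊗ id) t and the cyclic permutation a ⊗ b ⊗ c |-> b ⊗ c ⊗ a *)
Definition tmapl (k : fieldType) (V W : lmodType k) (f : V -> W)
    (t : tensor V V) : tensor W V := tlift (fun a b => f a ⊗ b) t.

Definition tcyc (k : fieldType) (V : lmodType k) (t : tensor (tensor V V) V) :
    tensor (tensor V V) V :=
  tlift (fun s c => tlift (fun a b => b ⊗ c ⊗ a) s) t.

(* The cobracket takes values in Im (1 - tau), tau the flip; in characteristic
   other than 2 this is antisymmetry, and in characteristic 2 it is what makes
   the bracket of the dual alternating. *)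
HB.mixin Record Lie_isBialgebra (k : fieldType) g of LieAlgebra k g := {
  cobr : g -> tensor g g;
  cobr_linear : linear cobr;
  cobr_alt : forall x, exists t, cobr x = t - tswap t;
  cobr_jacobi : forall x, let t := tmapl cobr (cobr x) in
    t + tcyc t + tcyc (tcyc t) = 0;
  cobr_cocycle : forall x y, cobr ⁅x, y⁆ = adT x (cobr y) - adT y (cobr x)
}.

#[short(type="lieBialgType")]
HB.structure Definition LieBialgebra (k : fieldType) :=
  {g of Lie_isBialgebra k g & LieAlgebra k g}.

HB.instance Definition _ (k : fieldType) (g : lieBialgType k) :=
  GRing.isLinear.Build k g (tensor g g) *:%R cobr cobr_linear.

HB.mixin Record Bialgebra_isQuasitriangular (k : fieldType) g
    of LieBialgebra k g := {
  rmat : tensor g g;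
  cobr_rmat : forall x : g, cobr x = adT x rmat;
  rmat_cybe : cybe rmat = 0
}.

#[short(type="qtLieBialgType")]
HB.structure Definition QuasitriangularLieBialgebra (k : fieldType) :=
  {g of Bialgebra_isQuasitriangular k g & LieBialgebra k g}.

Section Bialgebra.
Variables (k : fieldType) (g : lieBialgType k).
Implicit Types (x y z : g) (xi eta zeta : dualsp g).

(* ad*_xi x for xi in g*, x in g; see coad_dualE for the defining identity *)
Definition coad_dual xi x : g := - contrl xi (cobr x).

Lemma dual_lie_subproof xi eta :
  linear ((fun x => tpair xi eta (cobr x)) : g -> k^o).
Proof. by move=> a x y; rewrite !linearP. Qed.

Definition dual_lie xi eta : dualsp g := mkdual (dual_lie_subproof xi eta).

Lemma dual_lieE xi eta x : dual_lie xi eta x = eta (contrl xi (cobr x)).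
Proof. by rewrite /= tpair_contrl. Qed.

Lemma coad_dualE xi eta x : eta (coad_dual xi x) = - dual_lie xi eta x.
Proof. by rewrite dual_lieE linearN. Qed.

Lemma contrr_cobr xi x : contrr xi (cobr x) = - contrl xi (cobr x).
Proof.
have [t ->] := cobr_alt x.
by rewrite (linearB (contrr _)) (linearB (contrl _)) /= contrl_swap contrr_swap opprB.
Qed.

Lemma dual_lie_alt xi : dual_lie xi xi = 0.
Proof.
apply: dualP => x /=; have [t ->] := cobr_alt x.
rewrite linearB /= [tpair _ _ (tswap _)]tpair_contrl contrl_swap.
by rewrite -tpair_contrr subrr.
Qed.

Lemma dual_lie_bil : bilinear_for *:%R *:%R dual_lie.
Proof.
split=> [w a v v'|v a w w']; apply: dualP => x.
  by rewrite dualD dualZ !dual_lieE contrlDl linearP.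
by rewrite dualD dualZ !dual_lieE.
Qed.

Lemma dual_lieC xi eta : dual_lie xi eta = - dual_lie eta xi.
Proof.
apply: dualP => x.
by rewrite dualN /= tpair_contrl tpair_contrr contrr_cobr linearN opprK.
Qed.

Lemma contrl_cobr_lie xi x y : contrl xi (cobr ⁅x, y⁆) =
  ⁅x, contrl xi (cobr y)⁆ - contrl (coad x xi) (cobr y)
  - (⁅y, contrl xi (cobr x)⁆ - contrl (coad y xi) (cobr x)).
Proof. by rewrite cobr_cocycle linearB /= !contrl_adT. Qed.

Let contr3 eta zeta (t : tensor (tensor g g) g) : g :=
  tlift (fun s c => tpair eta zeta s *: c) t.

Let contr3_bil eta zeta : bilinear_for *:%R *:%R
  (fun (s : tensor g g) (c : g) => tpair eta zeta s *: c).
Proof.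
split=> [w a v v'|v a w w'] /=; first by rewrite linearP scalerDl scalerA.
by rewrite scalerDr !scalerA mulrC.
Qed.

Let contr3_linear eta zeta : linear (contr3 eta zeta).
Proof. exact: tlift_is_linear (contr3_bil eta zeta). Qed.

Let contr3E eta zeta s c : contr3 eta zeta (s ⊗ c) = tpair eta zeta s *: c.
Proof. exact: tliftE (contr3_bil eta zeta). Qed.

Let cobrl_bil : bilinear_for *:%R *:%R (fun a b : g => cobr a ⊗ b).
Proof. by split=> [w a v v'|v a w w'] /=; rewrite ?linearP ?linearPl ?linearPr. Qed.

Let rot1_bil (c : g) : bilinear_for *:%R *:%R (fun a b : g => b ⊗ c ⊗ a).
Proof.
by split=> [w a v v'|v a w w'] /=; rewrite ?linearPl ?linearPr ?linearPl.
Qed.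

Let rot_bil : bilinear_for *:%R *:%R
  (fun (s : tensor g g) (c : g) => tlift (fun a b => b ⊗ c ⊗ a) s).
Proof.
split=> [w a v v'|v a w w'] /=; first exact: tlift_is_linear (rot1_bil w) _ _ _.
by apply: tlift_linB => x y; rewrite linearPr linearPl.
Qed.

Let tcyc_linear : linear (@tcyc k g).
Proof. exact: tlift_is_linear rot_bil. Qed.

Lemma tcycE a b c : tcyc (a ⊗ b ⊗ c : tensor (tensor g g) g) = b ⊗ c ⊗ a.
Proof. by rewrite /tcyc (tliftE _ _ rot_bil) (tliftE _ _ (rot1_bil c)). Qed.

Let tmapl_linear : linear (tmapl (@cobr k g)).
Proof. exact: tlift_is_linear cobrl_bil. Qed.

Let tmaplE (a b : g) : tmapl cobr (a ⊗ b) = cobr a ⊗ b.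
Proof. exact: tliftE cobrl_bil. Qed.

Let contr3_tmapl eta zeta t :
  contr3 eta zeta (tmapl cobr t) = contrl (dual_lie eta zeta) t.
Proof.
apply: (tensor_eq (f := fun t => contr3 eta zeta (tmapl cobr t))) t
  => [a t u|a t u|a b].
- by rewrite tmapl_linear contr3_linear.
- by rewrite linearP.
- by rewrite tmaplE contr3E contrlE.
Qed.

Let contr3_tcyc eta zeta s b :
  contr3 eta zeta (tcyc (s ⊗ b)) = zeta b *: contrr eta s.
Proof.
apply: (tensor_eq (f := fun s => contr3 eta zeta (tcyc (s ⊗ b)))
  (h := fun s => zeta b *: contrr eta s)) s => [a t u|a t u|c d].
- by rewrite linearPl tcyc_linear contr3_linear.
- by rewrite linearP /= scalerDr !scalerA mulrC.
- by rewrite tcycE contr3E contrrE tpairE scalerA mulrC.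
Qed.

Let contr3_tcyc2 eta zeta s b :
  contr3 eta zeta (tcyc (tcyc (s ⊗ b))) = eta b *: contrl zeta s.
Proof.
apply: (tensor_eq (f := fun s => contr3 eta zeta (tcyc (tcyc (s ⊗ b))))
  (h := fun s => eta b *: contrl zeta s)) s => [a t u|a t u|c d].
- by rewrite linearPl !tcyc_linear contr3_linear.
- by rewrite linearP /= scalerDr !scalerA mulrC.
- by rewrite !tcycE contr3E contrlE tpairE scalerA.
Qed.

Lemma contrl_dual_lie eta zeta x :
  contrl (dual_lie eta zeta) (cobr x) =
  contrl zeta (cobr (contrl eta (cobr x)))
  - contrl eta (cobr (contrl zeta (cobr x))).
Proof.
have := congr1 (contr3 eta zeta) (cobr_jacobi x); rewrite /=.
set t := tmapl _ _.
have contr3D u v :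
  contr3 eta zeta (u + v) = contr3 eta zeta u + contr3 eta zeta v.
  by rewrite -[u]scale1r contr3_linear !scale1r.
have -> : contr3 eta zeta 0 = 0.
  by rewrite -(subrr 0) -scaleN1r addrC contr3_linear scaleN1r addNr.
rewrite !contr3D contr3_tmapl.
have -> : contr3 eta zeta (tcyc t) = contrl eta (cobr (contrl zeta (cobr x))).
  transitivity (- contrl eta (cobr (contrr zeta (cobr x)))); last first.
    by rewrite contrr_cobr !linearN opprK.
  apply: (tensor_eq (f := fun s => contr3 eta zeta (tcyc (tmapl cobr s)))
    (h := fun s => - contrl eta (cobr (contrr zeta s)))) (cobr x)
    => [a s u|a s u|c d].
  - by rewrite tmapl_linear tcyc_linear contr3_linear.
  - by rewrite (linearP (contrr _)) !linearP.
  - by rewrite tmaplE contr3_tcyc contrr_cobr contrrE !linearZ /= scalerN.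
have -> : contr3 eta zeta (tcyc (tcyc t))
    = - contrl zeta (cobr (contrl eta (cobr x))).
  transitivity (contrl zeta (cobr (contrr eta (cobr x)))); last first.
    by rewrite contrr_cobr !linearN.
  apply: (tensor_eq (f := fun s => contr3 eta zeta (tcyc (tcyc (tmapl cobr s))))
    (h := fun s => contrl zeta (cobr (contrr eta s)))) (cobr x)
    => [a s u|a s u|c d].
  - by rewrite tmapl_linear !tcyc_linear contr3_linear.
  - by rewrite (linearP (contrr _)) !linearP.
  - by rewrite tmaplE contr3_tcyc2 contrrE !linearZ.
by move=> /eqP; rewrite -addrA addr_eq0 opprB => /eqP ->; rewrite addrC.
Qed.

Lemma dual_lie_jacobi xi eta zeta :
  dual_lie xi (dual_lie eta zeta) + dual_lie eta (dual_lie zeta xi)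
  + dual_lie zeta (dual_lie xi eta) = 0.
Proof.
rewrite [dual_lie zeta xi]dual_lieC [dual_lie zeta (_ xi eta)]dual_lieC.
apply: dualP => x; rewrite !(dualD, dualN) !dual_lieE dualN dual_lieE.
by rewrite contrl_dual_lie linearB /= subrr.
Qed.

HB.instance Definition _ := Lmodule_isLie.Build k (dualsp g)
  dual_lie_bil dual_lie_alt dual_lie_jacobi.
End Bialgebra.

Lemma double_cancel1 (A : zmodType)
    (a b c d0 d1 d2 d3 d4 d5 d6 d7 d8 d9 d10 d11 d12 d13 d14 d15 d16 d17 : A) :
  a + b + c = 0 ->
  a + d0 - d1 + d2 - d3 + d4 - d5 - d6 + d7 + d8 - d9 - d10 + d11 + b + d6 -
  d12 + d10 - d13 + d9 - d14 - d15 + d5 + d1 - d16 - d17 + d3 + c + d15 - d8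
  + d17 - d11 + d16 - d7 - d0 + d14 + d12 - d4 - d2 + d13 = 0.
Proof.
rewrite (ACl (1*14*27*(2*34)*(23*3)*(4*38)*(26*5)*(6*37)*(22*7)*(15*8)*(9*33)*(10*29)*(19*11)*(17*12)*(13*31)*(36*16)*(39*18)*(35*20)*(28*21)*(32*24)*(30*25))) /=.
by rewrite !subrr !addr0.
Qed.

Lemma double_cancel2 (A : zmodType)
    (a b c d0 d1 d2 d3 d4 d5 d6 d7 d8 d9 d10 d11 d12 d13 d14 d15 d16 d17 : A) :
  a + b + c = 0 ->
  a - d0 + d1 + d2 + d3 + d4 - d5 + d6 - d7 - d8 + d9 - d10 + d11 + b - d12
  - d3 + d0 + d13 + d10 - d14 + d8 - d15 - d16 + d7 - d17 + d5 + c - d2 -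
  d13 + d12 - d1 + d17 - d11 + d16 - d9 - d6 + d15 - d4 + d14 = 0.
Proof.
rewrite (ACl (1*14*27*(17*2)*(3*31)*(4*28)*(5*16)*(6*38)*(26*7)*(8*36)*(24*9)*(21*10)*(11*35)*(19*12)*(13*33)*(30*15)*(18*29)*(39*20)*(37*22)*(34*23)*(32*25))) /=.
by rewrite !subrr !addr0.
Qed.

Section Double.
Variables (k : fieldType) (g : lieBialgType k).
Implicit Types (x y z : g) (xi eta zeta : dualsp g).

Definition ldouble : Type := g * dualsp g.

HB.instance Definition _ := GRing.Lmodule.on ldouble.

(* [x + xi, y + eta], expanded from [x, eta] = ad*_x eta - ad*_eta x *)
Definition double_lie (u v : ldouble) : ldouble :=
  (⁅u.1, v.1⁆ - coad_dual v.2 u.1 + coad_dual u.2 v.1,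
   ⁅u.2, v.2⁆ + coad u.1 v.2 - coad v.1 u.2).

Lemma coadDl a x y xi : coad (a *: x + y) xi = a *: coad x xi + coad y xi.
Proof.
apply: dualP => z.
by rewrite dualD dualZ !coadE linearPl linearP opprD mulrN.
Qed.

Lemma coadDr a x xi eta : coad x (a *: xi + eta) = a *: coad x xi + coad x eta.
Proof.
by apply: dualP => z; rewrite dualD dualZ !coadE dualD dualZ opprD mulrN.
Qed.

Lemma double_lie_bil : bilinear_for *:%R *:%R double_lie.
Proof.
split=> [w a v v'|v a w w']; congr pair; rewrite /= /coad_dual.
- rewrite linearPl !linearP contrlDl /= !(scalerBr, scalerDr, opprD, scalerN).
  by rewrite !addrA (ACl (1*3*5*2*4*6)).
- rewrite linearPl coadDl coadDr /= !(scalerBr, scalerDr, opprD, scalerN).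
  by rewrite !addrA (ACl (1*3*5*2*4*6)).
- rewrite linearPr !linearP contrlDl /= !(scalerBr, scalerDr, opprD, scalerN).
  by rewrite !addrA (ACl (1*3*5*2*4*6)).
- rewrite linearPr coadDl coadDr /= !(scalerBr, scalerDr, opprD, scalerN).
  by rewrite !addrA (ACl (1*3*5*2*4*6)).
Qed.

Lemma double_liexx u : double_lie u u = 0.
Proof.
congr pair; rewrite /= liexx add0r; first by rewrite addNr.
by rewrite subrr.
Qed.

Let C xi x := contrl xi (cobr x).

Let CE xi x : contrl xi (cobr x) = C xi x. Proof. by []. Qed.

Let CD xi x y : C xi (x + y) = C xi x + C xi y.
Proof. by rewrite /C !linearD. Qed.

Let CN xi x : C xi (- x) = - C xi x.
Proof. by rewrite /C !linearN. Qed.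

Let CDl xi eta x : C (xi + eta) x = C xi x + C eta x.
Proof. exact: contrlD. Qed.

Let CNl xi x : C (- xi) x = - C xi x.
Proof. exact: contrlN. Qed.

Let lieDN := (fun x y z : g => linearDr lie x y z : ⁅x, y + z⁆ = ⁅x, y⁆ + ⁅x, z⁆,
  fun x y : g => linearNr lie x y : ⁅x, - y⁆ = - ⁅x, y⁆).

Let dlieE xi eta x : ⁅xi, eta⁆ x = eta (C xi x).
Proof. exact: dual_lieE. Qed.

Lemma coad_lie x y xi :
  coad ⁅x, y⁆ xi = coad x (coad y xi) - coad y (coad x xi).
Proof.
apply: dualP => z; rewrite dualD dualN !coadE !opprK -linearB -linearN /=.
congr (xi _); have /eqP := lie_jacobi x y z.
rewrite [⁅z, x⁆]lieC linearNr /= [⁅z, ⁅x, y⁆⁆]lieC subr_eq0 => /eqP <-.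
by rewrite opprB.
Qed.

Lemma coad_dual_lie x eta zeta : coad x ⁅eta, zeta⁆ =
  ⁅coad x eta, zeta⁆ + ⁅eta, coad x zeta⁆
  + coad (C eta x) zeta - coad (C zeta x) eta.
Proof.
apply: dualP => t; rewrite !(dualD, dualN, coadE, dlieE).
have -> : C eta ⁅x, t⁆ = _ := contrl_cobr_lie eta x t; rewrite !CE.
have -> : eta ⁅C zeta x, t⁆ = - zeta (C (coad t eta) x).
  transitivity (- ⁅coad t eta, zeta⁆ x); last by rewrite dlieE.
  rewrite [⁅coad _ _, _⁆]lieC dualN opprK dlieE coadE lieC.
  by rewrite -linearN.
rewrite [⁅C eta x, t⁆]lieC !(linearD zeta) !(linearN zeta) /=.
rewrite (linearB zeta) /= !(opprD, opprK) !addrA.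
by rewrite (ACl (2*1*3*4)).
Qed.

Let coadD x xi eta : coad x (xi + eta) = coad x xi + coad x eta.
Proof. by have := coadDr 1 x xi eta; rewrite !scale1r. Qed.

Let coadN x xi : coad x (- xi) = - coad x xi.
Proof. by apply: dualP => y; rewrite dualN !coadE dualN. Qed.

Let coadDv x y xi : coad (x + y) xi = coad x xi + coad y xi.
Proof. by have := coadDl 1 x y xi; rewrite !scale1r. Qed.

Let coadNv x xi : coad (- x) xi = - coad x xi.
Proof. by apply: dualP => y; rewrite dualN !coadE linearNl linearN. Qed.

Let dlieDN := (fun x y z : dualsp g =>
    linearDr lie x y z : ⁅x, y + z⁆ = ⁅x, y⁆ + ⁅x, z⁆,
  fun x y : dualsp g => linearNr lie x y : ⁅x, - y⁆ = - ⁅x, y⁆).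

Let CD3 eta zeta x :
  C (dual_lie eta zeta) x = C zeta (C eta x) - C eta (C zeta x).
Proof. exact: contrl_dual_lie. Qed.

Let CL xi x y : C xi ⁅x, y⁆ =
  ⁅x, C xi y⁆ - C (coad x xi) y - (⁅y, C xi x⁆ - C (coad y xi) x).
Proof. exact: contrl_cobr_lie. Qed.

Let double_jacobi1 x y z xi eta zeta (u := (x, xi) : ldouble)
    (v := (y, eta) : ldouble) (w := (z, zeta) : ldouble) :
  (double_lie u (double_lie v w)).1 + (double_lie v (double_lie w u)).1
  + (double_lie w (double_lie u v)).1 = 0.
Proof.
rewrite /= /coad_dual !CE.
rewrite !opprK !(CD, CN, CDl, CNl, lieDN) /= !(opprK, opprD).
rewrite !CD3 !CL !(opprK, opprD) !addrA.
exact/double_cancel1/lie_jacobi.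
Qed.

Let double_jacobi2 x y z xi eta zeta (u := (x, xi) : ldouble)
    (v := (y, eta) : ldouble) (w := (z, zeta) : ldouble) :
  (double_lie u (double_lie v w)).2 + (double_lie v (double_lie w u)).2
  + (double_lie w (double_lie u v)).2 = 0.
Proof.
rewrite /= /coad_dual !CE.
rewrite !opprK !(coadD, coadN, coadDv, coadNv, dlieDN) /=.
rewrite !coad_lie !coad_dual_lie [⁅xi, coad z eta⁆]lieC.
rewrite [⁅xi, coad y zeta⁆]lieC [⁅zeta, coad x eta⁆]lieC [⁅eta, coad z xi⁆]lieC.
rewrite !(opprK, opprD) !addrA.
exact/double_cancel2/lie_jacobi.
Qed.

Lemma double_lie_jacobi u v w :
  double_lie u (double_lie v w) + double_lie v (double_lie w u)
  + double_lie w (double_lie u v) = 0.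
Proof.
case: u v w => [x xi] [y eta] [z zeta].
by congr pair; [exact: double_jacobi1|exact: double_jacobi2].
Qed.

HB.instance Definition _ := Lmodule_isLie.Build k ldouble
  double_lie_bil double_liexx double_lie_jacobi.

End Double.

Section Subspaces.
Variables (k : fieldType) (V : lmodType k).

Definition lspan (X : V -> Prop) : {pred V} := fun v =>
  `[< forall S : {pred V}, submod_closed S -> (forall x, X x -> x \in S) ->
      v \in S >].

Lemma lspan_submod_closed X : submod_closed (lspan X).
Proof.
split=> [|a u v /asboolP Xu /asboolP Xv]; apply/asboolP => S Smod XS.
  by case: Smod.
by case: (Smod) => _; apply; [exact: Xu|exact: Xv].
Qed.

HB.instance Definition _ X := GRing.isSubmodClosed.Build k V (lspan X)
  (lspan_submod_closed X).

Lemma mem_lspan (X : V -> Prop) x : X x -> x \in lspan X.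
Proof. by move=> Xx; apply/asboolP => S _; apply. Qed.

Definition component (t : tensor V V) (v : V) : Prop :=
  exists xi, v = contrl xi t \/ v = contrr xi t.

Definition annih (S : {pred V}) : {pred dualsp V} := fun eta =>
  `[< forall y, y \in S -> eta y = 0 >].

Lemma annih_submod_closed S : submod_closed (annih S).
Proof.
split=> [|a u v /asboolP Su /asboolP Sv]; apply/asboolP => y yS //.
by rewrite dualD dualZ Su // Sv // mulr0 addr0.
Qed.

HB.instance Definition _ S := GRing.isSubmodClosed.Build k (dualsp V) (annih S)
  (annih_submod_closed S).
End Subspaces.

Section Quasitriangular.
Variables (k : fieldType) (g : qtLieBialgType k).
Implicit Types (x y z : g) (xi eta zeta : dualsp g).

Definition Omega : tensor g g := rmat + tswap rmat.

Definition fmem : {pred g} := lspan (component Omega).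

Record fideal : Type := Fideal { fval :> g; fvalP : fval \in fmem }.

HB.instance Definition _ := [isSub for fval].
HB.instance Definition _ := [Choice of fideal by <:].
HB.instance Definition _ := [SubChoice_isSubLmodule of fideal by <:].

Definition fperp_mem : {pred dualsp g} := annih fmem.

Record fperp : Type := Fperp { fpval :> dualsp g; fpvalP : fpval \in fperp_mem }.

HB.instance Definition _ := [isSub for fpval].
HB.instance Definition _ := [Choice of fperp by <:].
HB.instance Definition _ := [SubChoice_isSubLmodule of fperp by <:].

Definition rplus xi : g := contrl xi rmat.
Definition rminus xi : g := - contrr xi rmat.

Lemma adT_Omega x : adT x Omega = 0.
Proof.
rewrite linearD /= adT_swap -cobr_rmat.
have [t ->] := cobr_alt x.
by rewrite linearB /= tswapK addrA subrK subrr.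
Qed.

Lemma Omega_swap : tswap Omega = Omega.
Proof. by rewrite linearD /= tswapK addrC. Qed.

Lemma fmemP y : reflect (exists xi, y = contrl xi Omega) (y \in fmem).
Proof.
apply: (iffP idP) => [/asboolP fy|[xi ->]]; last first.
  by apply: mem_lspan; exists xi; left.
pose S : {pred g} := fun y => `[< exists xi, y = contrl xi Omega >].
suff /asboolP : y \in S by [].
apply: fy => [|x [xi [->|->]]].
- split=> [|a u v /asboolP [xi ->] /asboolP [eta ->]]; apply/asboolP.
    by exists 0; rewrite contrl0.
  by exists (a *: xi + eta); rewrite contrlDl.
- by apply/asboolP; exists xi.
- by apply/asboolP; exists xi; rewrite -{1}Omega_swap contrr_swap.
Qed.

Lemma rpm_contrl xi : rplus xi - rminus xi = contrl xi Omega.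
Proof. by rewrite /rplus /rminus opprK linearD /= contrl_swap. Qed.

Lemma rpm_fmem xi : rplus xi - rminus xi \in fmem.
Proof. by rewrite rpm_contrl; apply/fmemP; exists xi. Qed.

Lemma lie_fmem x y : y \in fmem -> ⁅x, y⁆ \in fmem.
Proof.
move=> /fmemP [xi ->]; apply/fmemP; exists (coad x xi).
by have /eqP := contrl_adT x xi Omega; rewrite adT_Omega linear0 eq_sym subr_eq0 => /eqP.
Qed.

Definition fperp_lie (eta zeta : fperp) : fperp := 0.

Lemma fperp_lie_bil : bilinear_for *:%R *:%R fperp_lie.
Proof. by split=> [w a v v'|v a w w']; rewrite /fperp_lie /= scaler0 addr0. Qed.

Lemma fperp_liexx (eta : fperp) : fperp_lie eta eta = 0.
Proof. by []. Qed.

Lemma fperp_lie_jacobi (xi eta zeta : fperp) :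
  fperp_lie xi (fperp_lie eta zeta) + fperp_lie eta (fperp_lie zeta xi)
  + fperp_lie zeta (fperp_lie xi eta) = 0.
Proof. by rewrite /fperp_lie !addr0. Qed.

HB.instance Definition _ := Lmodule_isLie.Build k fperp
  fperp_lie_bil fperp_liexx fperp_lie_jacobi.

Definition semidirect : Type := g * fideal.

HB.instance Definition _ := GRing.Lmodule.on semidirect.

Lemma semi_lie_subproof (u v : semidirect) :
  ⁅u.1, v.2 : g⁆ - ⁅v.1, u.2 : g⁆ + ⁅u.2 : g, v.2 : g⁆ \in fmem.
Proof.
by rewrite rpredD ?rpredB ?lie_fmem // ?fvalP //; exact: fvalP.
Qed.

Definition semi_lie (u v : semidirect) : semidirect :=
  (⁅u.1, v.1⁆, Fideal (semi_lie_subproof u v)).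

(* (x, y) |-> x + y and (x, y) |-> x are jointly injective Lie maps. *)
Let semi_sum (u : semidirect) : g := u.1 + fval u.2.

Let semi_eq u v : u.1 = v.1 -> semi_sum u = semi_sum v -> u = v.
Proof.
case: u v => [x y] [x' y'] /= -> /addrI yy'; congr pair; exact: val_inj.
Qed.

Let semi_sum_lie u v : semi_sum (semi_lie u v) = ⁅semi_sum u, semi_sum v⁆.
Proof.
rewrite /semi_sum /= linearDl !linearDr /= [⁅fval u.2, v.1⁆]lieC.
by rewrite !addrA.
Qed.

Let semi_sumP a u v : semi_sum (a *: u + v) = a *: semi_sum u + semi_sum v.
Proof. by rewrite /semi_sum /= scalerDr addrACA. Qed.

Lemma semi_lie_bil : bilinear_for *:%R *:%R semi_lie.
Proof.
split=> [w a v v'|v a w w']; apply: semi_eq; rewrite /= ?linearPl ?linearPr //.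
  by rewrite semi_sumP !semi_sum_lie semi_sumP linearPl.
by rewrite semi_sumP !semi_sum_lie semi_sumP linearPr.
Qed.

Lemma semi_liexx u : semi_lie u u = 0.
Proof.
apply: semi_eq; first exact: liexx.
by rewrite semi_sum_lie liexx /semi_sum /= addr0.
Qed.

Lemma semi_lie_jacobi u v w :
  semi_lie u (semi_lie v w) + semi_lie v (semi_lie w u)
  + semi_lie w (semi_lie u v) = 0.
Proof.
have sumD s t : semi_sum (s + t) = semi_sum s + semi_sum t.
  by have := semi_sumP 1 s t; rewrite !scale1r.
apply: semi_eq; first exact: lie_jacobi.
by rewrite !sumD !semi_sum_lie lie_jacobi /semi_sum /= addr0.
Qed.

HB.instance Definition _ := Lmodule_isLie.Build k semidirect
  semi_lie_bil semi_liexx semi_lie_jacobi.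

Definition i_map (eta : fperp) : ldouble g := (- rplus eta, eta : dualsp g).

Definition p_map (u : ldouble g) : semidirect :=
  (u.1 + rplus u.2, - Fideal (rpm_fmem u.2)).
End Quasitriangular.

Definition lie_hom (k : fieldType) (a b : lieAlgType k) (f : a -> b) : Prop :=
  linear f /\ forall x y, f ⁅x, y⁆ = ⁅f x, f y⁆.

Definition lie_short_exact (k : fieldType) (a b c : lieAlgType k)
    (i : a -> b) (p : b -> c) : Prop :=
  [/\ lie_hom i, lie_hom p, injective i,
      forall v, p v = 0 <-> exists u, i u = v
    & forall w, exists v, p v = w].

(* Main.v *)
Require Import Defs.
From HB Require Import structures.
From mathcomp Require Import all_boot all_algebra.
From mathcomp Require Import boolp classical_sets.

(* The maps x + xi |-> x + r_+ xi and x + xi |-> x + r_- xi are Lie homomorphisms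
   from the double onto g: contracting the classical Yang-Baxter equation in its
   first two (resp. last two) slots shows that r_+ (resp. r_-) is one, and the
   mixed brackets are handled by cobr x = adT x r.  The components of p are the
   first map and the difference of the two.  That im i lies in ker p uses that
   Omega is symmetric and that, g being possibly infinite dimensional, the
   functionals on g separate points; this comes from Zorn's lemma. *)

Set Implicit Arguments.
Unset Strict Implicit.
Unset Printing Implicit Defensive.

Import GRing.Theory.
Local Open Scope ring_scope.

(** * Linear functionals separate the points of a vector space *)

Section SeparatingFunctional.
Variables (k : fieldType) (V : lmodType k) (v : V).
Local Open Scope classical_set_scope.

(* A subspace not containing v, closed under unions of nonempty chains; the
   empty set is allowed so that the empty chain needs no special treatment. *)
Let avoids (S : set V) :=
  ~ S v /\ forall a x y, S x -> S y -> S (a *: x + y).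

(** A maximal [S] avoiding [v] is a complement of the line through [v]. If no multiple of [v]
    brought [x] into [S], then [S + kx] would be larger and still avoid [v]: given [v - b *: x] in
    [S], either [b = 0] and [S] contains [v], or division by [-b] puts [x - b^-1 *: v] in [S]. *)
Lemma maximal_avoiding_subspace : v != 0 ->
  exists S : set V, [/\ S 0, avoids S & forall x, exists a, S (x - a *: v)].
Proof.
move=> v0.
have [F FA totF|S [[Sv Slin] Smax]] := @Zorn_bigcup V avoids.
  split=> [[S FS Sv]|a x y [S FS Sx] [T FT Ty]]; first by have [] := FA _ FS.
  have [ST|TS] := totF _ _ FS FT.
    by exists T => //; apply: (FA _ FT).2 => //; exact: ST.
  by exists S => //; apply: (FA _ FS).2 => //; exact: TS.
(* [S] could only miss 0 by being empty, and then the zero subspace is a larger candidate, as [v] is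
   nonzero. *)
have S0 : S 0.
  apply: contrapT => nS0; apply: (Smax (S `|` [set 0])).
    by split=> [x Sx|/(_ 0)]; [left|move=> S0; apply: nS0; apply: S0; right].
  have empty x : ~ S x.
    by move=> Sx; apply: nS0; have := Slin (-1) x x Sx Sx; rewrite scaleN1r addNr.
  split=> [[//|/eqP]|a x y [/empty//|->] [/empty//|->]]; first by rewrite (negbTE v0).
  by right; rewrite scaler0 addr0.
have SZ a x : S x -> S (a *: x) by move=> Sx; have := Slin a _ _ Sx S0; rewrite addr0.
exists S; split=> // x; apply: contrapT => noa.
pose T : set V := [set y | exists b, S (y - b *: x)].
apply: (Smax T).
  split=> [y Sy|/(_ x) TS]; first by exists 0; rewrite scale0r subr0.
  apply: noa; exists 0; rewrite scale0r subr0; apply: TS.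
  by exists 1; rewrite scale1r subrr.
split=> [[b Sb]|a y z [b Sb] [c Sc]]; last first.
  exists (a * b + c); have := Slin a _ _ Sb Sc.
  by rewrite scalerBr scalerDl !scalerA opprD addrACA.
have [b0|b0] := eqVneq b 0; first by apply: Sv; rewrite b0 scale0r subr0 in Sb.
apply: noa; exists b^-1; have := SZ (- b^-1) _ Sb.
by rewrite scalerBr scalerA mulNr mulVf // scaleN1r opprK scaleNr addrC.
Qed.

(** The separating functional sends [x] to its coefficient along [v] modulo the complement [S];
    uniqueness of that coefficient gives linearity and the value 1 at [v]. *)
Lemma dual_separates : (forall xi : dualsp V, xi v = 0) -> v = 0.
Proof.
move=> xiv0; apply/eqP; apply: contrapT => /negP v0.
have [S [S0 [Sv Slin] /choice[f Sf]]] := maximal_avoiding_subspace v0.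
have uniq x a b : S (x - a *: v) -> S (x - b *: v) -> a = b.
  move=> Sa Sb; apply/eqP; rewrite -subr_eq0; apply: contrapT => /negP ab0.
  have Sab : S ((a - b) *: v).
    have := Slin (-1) _ _ Sa Sb.
    by rewrite scaleN1r opprB addrA subrK -scalerBl.
  by apply: Sv; have := Slin (a - b)^-1 _ _ Sab S0; rewrite addr0 scalerK.
have flin : linear (f : V -> k^o).
  move=> a x y; apply: (uniq (a *: x + y)) => //.
  have := Slin a _ _ (Sf x) (Sf y).
  by rewrite scalerBr scalerDl scalerA opprD addrACA.
have fv1 : f v = 1 by apply: (uniq v) => //; rewrite scale1r subrr.
by have /eqP := xiv0 (mkdual flin); rewrite /= fv1 oner_eq0.
Qed.
End SeparatingFunctional.

(** * Contractions of threefold tensors: [contr12] is xi ⊗ eta ⊗ id, [contr23] is id ⊗ xi ⊗ eta *)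

Lemma linear_tlift (k : fieldType) (V W U U' : lmodType k)
    (L : {linear U -> U'}) (B : V -> W -> U) (t : tensor V W) :
  L (tlift B t) = tlift (fun a b => L (B a b)) t.
Proof. exact: linear_sum. Qed.

Section TripleContractions.
Variables (k : fieldType) (V : lmodType k).
Implicit Types (xi eta : dualsp V).

Definition contr12 xi eta (t : tensor (tensor V V) V) : V :=
  tlift (fun s c => tpair xi eta s *: c) t.

Definition contr23 xi eta (t : tensor (tensor V V) V) : V :=
  tlift (fun s c => eta c *: contrr xi s) t.

Lemma contr12_bil xi eta : bilinear_for *:%R *:%R
  (fun (s : tensor V V) (c : V) => tpair xi eta s *: c).
Proof.
split=> [w a v v'|v a w w'] /=; first by rewrite linearP scalerDl scalerA.
by rewrite scalerDr !scalerA mulrC.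
Qed.

Lemma contr23_bil xi eta : bilinear_for *:%R *:%R
  (fun (s : tensor V V) (c : V) => eta c *: contrr xi s).
Proof.
split=> [w a v v'|v a w w'] /=; last by rewrite linearP scalerDl scalerA.
by rewrite linearP scalerDr !scalerA mulrC.
Qed.

Lemma contr12_linear xi eta : linear (contr12 xi eta).
Proof. exact: tlift_is_linear (contr12_bil xi eta). Qed.
Lemma contr23_linear xi eta : linear (contr23 xi eta).
Proof. exact: tlift_is_linear (contr23_bil xi eta). Qed.

HB.instance Definition _ xi eta := GRing.isLinear.Build k
  (tensor (tensor V V) V) V *:%R (contr12 xi eta) (contr12_linear xi eta).
HB.instance Definition _ xi eta := GRing.isLinear.Build k
  (tensor (tensor V V) V) V *:%R (contr23 xi eta) (contr23_linear xi eta).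

Lemma contr12E xi eta a b c : contr12 xi eta (a ⊗ b ⊗ c) = (xi a * eta b) *: c.
Proof. by rewrite /contr12 (tliftE _ _ (contr12_bil xi eta)) tpairE. Qed.
Lemma contr23E xi eta a b c : contr23 xi eta (a ⊗ b ⊗ c) = (eta c * xi b) *: a.
Proof. by rewrite /contr23 (tliftE _ _ (contr23_bil xi eta)) contrrE scalerA. Qed.
End TripleContractions.

(** * The Yang-Baxter expression contracted in two slots *)

Section ContractedCYBE.
Variables (k : fieldType) (g : lieAlgType k).
Implicit Types (x y : g) (xi eta : dualsp g) (r : tensor g g).

Lemma contrr_adT x xi r :
  contrr xi (adT x r) = ⁅x, contrr xi r⁆ - contrr (coad x xi) r.
Proof. by rewrite -!contrl_swap -adT_swap contrl_adT. Qed.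

(** [tlift] is a finite sum over a representative, so the three summands of [cybe] can be compared
    term by term. *)
Lemma linear_tlift2 (L : {linear tensor (tensor g g) g -> g})
    (B : g -> g -> g -> g -> tensor (tensor g g) g) r :
  L (tlift (fun a b => tlift (B a b) r) r) =
  \sum_(p <- repr r) \sum_(q <- repr r) L (B p.1 p.2 q.1 q.2).
Proof. by rewrite linear_tlift; apply: eq_bigr => p _; rewrite linear_tlift. Qed.

(** The bracket comes from [r_13, r_23], whose contracted legs are separate. In the other two
    summands a functional meets a bracket, which a coadjoint action absorbs. *)
Lemma contr12_cybe xi eta r : contr12 xi eta (cybe r) =
  ⁅contrl xi r, contrl eta r⁆
  - contrl (coad (contrr eta r) xi + coad (contrl xi r) eta) r.
Proof.
rewrite !linearD /= contrlD opprD [RHS]addrC !linear_tlift2.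
congr (_ + _ + _); rewrite /= /contrl /contrr /tlift /bisum.
(* The uncontracted leg belongs to the second copy of [r], so its sum is moved outside. *)
- rewrite exchange_big -sumrN; apply: eq_bigr => q _ /=.
  rewrite linear_sumlz linear_sum scaleNr opprK scaler_suml.
  apply: eq_bigr => p _; rewrite contr12E.
  by rewrite linearZl_LR linearZ /= mulrC.
- rewrite exchange_big -sumrN; apply: eq_bigr => q _ /=.
  rewrite linear_sumlz linear_sum scaleNr opprK scaler_suml.
  apply: eq_bigr => p _; rewrite contr12E.
  by rewrite linearZl_LR linearZ.
- rewrite linear_sumlz; apply: eq_bigr => p _; rewrite linear_sumr.
  apply: eq_bigr => q _; rewrite contr12E.
  by rewrite linearZl_LR linearZr_LR /= scalerA.
Qed.

(** Now [r_12, r_13] yields the bracket, and the correction involves the same functional as in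
    [contr12_cybe]. *)
Lemma contr23_cybe xi eta r : contr23 xi eta (cybe r) =
  ⁅contrr xi r, contrr eta r⁆
  + contrr (coad (contrr eta r) xi + coad (contrl xi r) eta) r.
Proof.
rewrite !linearD /= -[contrr (_ + _) r]contrl_swap contrlD !contrl_swap addrA !linear_tlift2.
congr (_ + _ + _); rewrite /= /contrl /contrr /tlift /bisum.
- rewrite linear_sumlz; apply: eq_bigr => p _; rewrite linear_sumr.
  apply: eq_bigr => q _; rewrite contr23E.
  by rewrite linearZl_LR linearZr_LR /= scalerA mulrC.
- apply: eq_bigr => p _ /=.
  rewrite lieC linearN opprK linear_sumr linear_sum scaler_suml.
  apply: eq_bigr => q _; rewrite contr23E.
  by rewrite linearZr_LR linearZ.
- apply: eq_bigr => p _ /=.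
  rewrite lieC linearN opprK linear_sumr linear_sum scaler_suml.
  apply: eq_bigr => q _; rewrite contr23E.
  by rewrite linearZr_LR linearZ /= mulrC.
Qed.
End ContractedCYBE.

(** * Homomorphisms from the double to g, and the maps i and p *)

Section DoubleExactSequence.
Variables (k : fieldType) (g : qtLieBialgType k).
Implicit Types (x y : g) (xi eta : dualsp g).

(** Moving ad_x from the legs of [rmat] onto the functionals identifies the correction in both
    contracted Yang-Baxter identities as the bracket of the dual. *)
Lemma dual_lie_coad xi eta :
  ⁅xi, eta⁆ = coad (contrr eta rmat) xi + coad (contrl xi rmat) eta.
Proof.
apply: dualP => x; rewrite [LHS]dual_lieE cobr_rmat contrl_adT linearB.
rewrite -[X in _ - X]tpair_contrl tpair_contrr dualD !coadE opprK addrC.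
by rewrite [⁅contrl _ _, x⁆]lieC linearN opprK [⁅x, _⁆]lieC linearN.
Qed.

Lemma rplus_lie xi eta : rplus ⁅xi, eta⁆ = ⁅rplus xi, rplus eta⁆.
Proof.
apply/eqP; rewrite eq_sym -subr_eq0 dual_lie_coad -contr12_cybe rmat_cybe.
by rewrite linear0.
Qed.

Lemma rminus_lie xi eta : rminus ⁅xi, eta⁆ = ⁅rminus xi, rminus eta⁆.
Proof.
have := contr23_cybe xi eta (@rmat k g).
rewrite rmat_cybe linear0 -dual_lie_coad => /esym/eqP.
by rewrite addr_eq0 /rminus linearNl linearNr /= opprK => /eqP.
Qed.

Definition dplus (u : ldouble g) : g := u.1 + rplus u.2.
Definition dminus (u : ldouble g) : g := u.1 + rminus u.2.

Lemma rplus_coad x xi : rplus (coad x xi) = ⁅x, rplus xi⁆ + coad_dual xi x.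
Proof.
by rewrite /coad_dual cobr_rmat contrl_adT opprB addrC subrK.
Qed.

(** Antisymmetry of the cobracket offsets the sign in [rminus], so the [coad_dual] term is that of
    [rplus_coad]. *)
Lemma rminus_coad x xi : rminus (coad x xi) = ⁅x, rminus xi⁆ + coad_dual xi x.
Proof.
rewrite /coad_dual -contrr_cobr cobr_rmat contrr_adT /rminus linearNr /=.
by rewrite addKr.
Qed.

Lemma rplusP a xi eta : rplus (a *: xi + eta) = a *: rplus xi + rplus eta.
Proof. exact: contrlDl. Qed.

Lemma rminusP a xi eta : rminus (a *: xi + eta) = a *: rminus xi + rminus eta.
Proof. by rewrite /rminus -!contrl_swap contrlDl opprD scalerN. Qed.

HB.instance Definition _ := GRing.isLinear.Build k (dualsp g) g *:%R
  (@rplus k g) rplusP.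
HB.instance Definition _ := GRing.isLinear.Build k (dualsp g) g *:%R
  (@rminus k g) rminusP.

(** The second hypothesis says that [x + xi |-> x + h xi] respects the mixed brackets [x, xi]. *)
Lemma eval_double_lie (h : {linear dualsp g -> g}) (u v : ldouble g) :
  (forall xi eta, h ⁅xi, eta⁆ = ⁅h xi, h eta⁆) ->
  (forall x xi, h (coad x xi) = ⁅x, h xi⁆ + coad_dual xi x) ->
  ⁅u, v⁆.1 + h ⁅u, v⁆.2 = ⁅u.1 + h u.2, v.1 + h v.2⁆.
Proof.
move=> hlie hcoad; case: u v => [x xi] [y eta] /=.
rewrite linearB linearD /= hlie !hcoad !linearDl !linearDr /= [⁅h xi, y⁆]lieC.
by rewrite opprD !addrA (ACl (1*5*7*4*(2*6)*(3*8))) /= addNr subrr !addr0.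
Qed.

Lemma dplus_lie u v : dplus ⁅u, v⁆ = ⁅dplus u, dplus v⁆.
Proof. exact: eval_double_lie rplus_lie rplus_coad. Qed.

Lemma dminus_lie u v : dminus ⁅u, v⁆ = ⁅dminus u, dminus v⁆.
Proof. exact: eval_double_lie rminus_lie rminus_coad. Qed.

(** Symmetry of Omega lets [eta] and [zeta] trade places in their pairing with it; the forward
    direction then separates points. *)
Lemma fperpP eta : reflect (contrl eta (Omega g) = 0) (eta \in @fperp_mem k g).
Proof.
apply: (iffP idP) => [/asboolP eta0|eta0].
  apply: dual_separates => zeta; rewrite -[Omega g]Omega_swap contrl_swap.
  rewrite -tpair_contrr tpair_contrl; apply: eta0.
  by apply/fmemP; exists zeta.
apply/asboolP => _ /fmemP[zeta ->].
by rewrite -tpair_contrl tpair_contrr -contrl_swap Omega_swap eta0 linear0.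
Qed.

(** Turns equalities in the semidirect sum into equalities in g, where [dplus] and [dminus] are
    homomorphisms. *)
Lemma p_map_eqP (u : ldouble g) (w : semidirect g) :
  p_map u = w <-> dplus u = w.1 /\ dminus u - dplus u = fval w.2.
Proof.
have sndE : fval (p_map u).2 = dminus u - dplus u.
  rewrite -[LHS]/(- (rplus u.2 - rminus u.2)) opprB /dminus /dplus.
  by rewrite [in RHS]opprD /= addrACA subrr add0r.
split=> [<-|[u1 u2]]; first by rewrite sndE.
case: w u1 u2 => [x y] /= u1 u2; rewrite [LHS]surjective_pairing.
by congr pair => //; apply: val_inj; exact: etrans sndE u2.
Qed.

Lemma dplusP a u v : dplus (a *: u + v) = a *: dplus u + dplus v.
Proof. by rewrite /dplus /= linearP scalerDr addrACA. Qed.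

Lemma dminusP a u v : dminus (a *: u + v) = a *: dminus u + dminus v.
Proof. by rewrite /dminus /= linearP scalerDr addrACA. Qed.

Lemma p_map_fst u : (p_map u).1 = dplus u.
Proof. by have [] := (p_map_eqP u _).1 erefl. Qed.

Lemma p_map_snd u : fval (p_map u).2 = dminus u - dplus u.
Proof. by have [] := (p_map_eqP u _).1 erefl. Qed.

Lemma p_map_hom : lie_hom (@p_map k g).
Proof.
split=> [a u v|u v]; apply/p_map_eqP; split.
- exact: dplusP.
- rewrite -[RHS]/(a *: fval (p_map u).2 + fval (p_map v).2) !p_map_snd.
  by rewrite dplusP dminusP [in RHS]scalerBr opprD addrACA.
- by rewrite dplus_lie -!p_map_fst.
- rewrite dplus_lie dminus_lie.
  transitivity (⁅dplus u, dminus v - dplus v⁆ - ⁅dplus v, dminus u - dplus u⁆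
    + ⁅dminus u - dplus u, dminus v - dplus v⁆); last by rewrite -!p_map_snd.
  (* What remains is [b, d] - [a, c] = [a, d - c] - [c, b - a] + [b - a, d - c]. *)
  move: (dplus u) (dminus u) (dplus v) (dminus v) => a b c d.
  rewrite [⁅c, _⁆]lieC opprK -addrA -linearDr /= [c + _]addrC subrK.
  by rewrite linearBl linearBr /= addrC addrA subrK.
Qed.

Lemma i_map_hom : lie_hom (@i_map k g).
Proof.
split=> [a eta zeta|eta zeta].
  by congr pair; rewrite /= linearP opprD scalerN.
(* On f-perp r_+ and r_- agree, so [dual_lie_coad] makes the bracket in the dual cancel the two
   coadjoint terms. *)
have snd0 : ⁅i_map eta, i_map zeta⁆.2 = 0.
  have r12 : contrr zeta rmat = - rplus zeta.
    apply/eqP; rewrite -addr_eq0 addrC -[X in _ + X]opprK rpm_contrl.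
    exact/eqP/fperpP/fpvalP.
  rewrite /= dual_lie_coad r12; apply: dualP => x.
  rewrite !(dualD, dualN, coadE) !linearNl !linearN !opprK /=.
  by rewrite -[contrl eta rmat]/(rplus eta) subrK subrr.
(* [dplus] kills the image of i; once the second component is 0, this forces the first to vanish
   too. *)
have : dplus ⁅i_map eta, i_map zeta⁆ = 0.
  by rewrite dplus_lie {1}/dplus /= addNr linear0l.
rewrite /dplus snd0 linear0 addr0 => fst0.
rewrite [RHS]surjective_pairing fst0 snd0; congr pair.
by rewrite /= linear0 oppr0.
Qed.
End DoubleExactSequence.

(** * Exactness of the sequence *)

Theorem proposition3p4 (k : fieldType) (g : qtLieBialgType k) :
  lie_short_exact (@i_map k g) (@p_map k g).
Proof.
split; [exact: i_map_hom|exact: p_map_hom|..].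
- by move=> eta zeta [_ etazeta]; apply: val_inj.
- move=> v; split=> [/p_map_eqP[v1 v2]|[eta <-]]; last first.
    apply/p_map_eqP; rewrite /dplus /dminus /= addNr; split=> //.
    rewrite subr0 addrC -opprB rpm_contrl.
    by rewrite (fperpP _ (fpvalP eta)) oppr0.
  (* Subtracting the two kernel equations leaves r_+ = r_- on [v.2]. *)
  have v2perp : v.2 \in @fperp_mem k g.
    apply/fperpP; rewrite -rpm_contrl; apply/eqP.
    move/eqP: v2; rewrite /dplus /dminus /= opprD addrACA subrr add0r.
    by rewrite -opprB oppr_eq0.
  exists (Fperp v2perp); rewrite [RHS]surjective_pairing /i_map /=.
  by congr pair; apply/esym/eqP; rewrite -addr_eq0; apply/eqP.
- case=> x y; have /fmemP[xi yxi] := fvalP y.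
  (* As [y] is (r_+ - r_-) xi, the dual part [- xi] produces [y], and [rplus xi] restores the first
     component to [x]. *)
  exists (x + rplus xi, - xi); apply/p_map_eqP.
  rewrite /dplus /dminus /= !linearN addrK yxi -rpm_contrl; split=> //.
  by rewrite addrAC [x + _]addrC addrK.
Qed.
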